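(* Let $L:\mathbb{R}^D\to\mathbb{R}$ be $\mathcal{C}^4$ and let $\Gamma\subset\mathbb{R}^D$ be a $\mathcal{C}^2$ submanifold of dimension $D-M$, for some integer $1\le M\le D$, such that every $x\in\Gamma$ is a local minimizer of $L$ and $\mathrm{rank}(\nabla^2L(x))=M$. Then the average-direction sharpness $$R^{\mathrm{Avg}}_\rho(x)=\mathbb{E}_{g\sim N(0,I)}L\bigl(x+\rho g/\|g\|_2\bigr)-L(x)$$ admits $\mathrm{Tr}(\nabla^2L(\cdot))/(2D)$ as a good limiting regularizer on $\Gamma$. Moreover it is mildly bounded below: for any bounded closed set $B\subset U$ there exists $C>0$ such that for all sufficiently small $\rho>0$ and all $x\in B$, $R^{\mathrm{Avg}}_\rho(x)\ge-C\rho^2$. Here $U$ is the attraction set of $\Gamma$.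
   Context: Gradient flow: $\phi(x,\tau)=x-\int_0^\tau\nabla L(\phi(x,t))\,dt$, $\Phi(x)=\lim_{\tau\to\infty}\phi(x,\tau)$ when it exists; $U=\{x:\Phi(x)\text{ exists and }\Phi(x)\in\Gamma\}$. For a family of functions $R_\rho:\mathbb{R}^D\to\mathbb{R}\cup\{\infty\}$, $\rho>0$, the limiting regularizer is $S:\Gamma\to\mathbb{R}$, $S(x)=\lim_{\rho\to0}\lim_{r\to0}\inf_{\|x'-x\|_2\le r}R_\rho(x')/\rho^2$. The limiting regularizer $S$ is good around $x^*\in\Gamma$ if $S$ is non-negative and continuous at $x^*$ and there is an open set $V_{x^*}\ni x^*$ such that for any $C,\epsilon>0$ there is $\rho_{x^*}>0$ with $\bigl|S(x)-\inf_{\|x'-x\|_2\le C\rho}R_\rho(x')/\rho^2\bigr|<\epsilon$ for all $x\in\Gamma\cap V_{x^*}$ and all $0<\rho\le\rho_{x^*}$. $\{R_\rho\}$ admits $S$ as a good limiting regularizer on $\Gamma$ if $S$ is its limiting regularizer and is good around every point of $\Gamma$. *)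

(* Defs.v *)
From HB Require Import structures.
From mathcomp Require Import all_boot all_order all_algebra.
From mathcomp Require Import all_classical all_reals all_analysis.

Set Implicit Arguments.
Unset Strict Implicit.
Unset Printing Implicit Defensive.

Import Order.TTheory GRing.Theory Num.Theory.
Import numFieldNormedType.Exports.

Local Open Scope classical_set_scope.
Local Open Scope ring_scope.

(* The library norm `|x| on 'rV[R]_n is the sup norm; it induces the same
   topology, the same bounded sets and the same derivatives as this one. *)
Definition l2norm {R : realType} {n : nat} (x : 'rV[R]_n) : R :=
  Num.sqrt (\sum_i x ord0 i ^+ 2).

(* k times continuously differentiable on U, for U open and V of finite
   dimension: f is differentiable and each directional derivative is of class
   C^(k-1). *)
Fixpoint Ck_on {R : realType} {V W : normedModType R} (k : nat) (U : set V)
    (f : V -> W) : Prop :=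
  if k is k'.+1 then
    (forall x, U x -> differentiable f x) /\ (forall v, Ck_on k' U ('D_v f))
  else forall x, U x -> {for x, continuous f}.

Section EuclideanSpace.
Context {R : realType} {D : nat}.
Implicit Types (L : 'rV[R]_D -> R) (Gamma : set 'rV[R]_D) (x : 'rV[R]_D).

Definition basis_vec (i : 'I_D) : 'rV[R]_D := delta_mx ord0 i.

Definition gradient L x : 'rV[R]_D := \row_i 'D_(basis_vec i) L x.

Definition hessian L x : 'M[R]_D :=
  \matrix_(i, j) 'D_(basis_vec j) ('D_(basis_vec i) L) x.

(* Near each of its points, Gamma is straightened to R^d x {0} by a C^k
   diffeomorphism f : A -> f(A) between open sets, with inverse g. *)
Definition Ck_submanifold (k d : nat) Gamma : Prop :=
  forall p, Gamma p ->
  exists (A : set 'rV[R]_D) (f g : 'rV[R]_D -> 'rV[R]_D),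
    [/\ open A, A p & open (f @` A)] /\
    [/\ Ck_on k A f, Ck_on k (f @` A) g, {in A, cancel f g} &
        forall x, A x ->
          (Gamma x <-> forall i : 'I_D, (d <= i)%N -> f x ord0 i = 0)].

Definition local_minimizer L x : Prop := \forall y \near x, L x <= L y.

(* y is the curve phi(x, .) on [0, +oo[; the integral equation is stated
   coordinatewise. *)
Definition gradient_flow L x (y : R -> 'rV[R]_D) : Prop :=
  {within `[0, +oo[, continuous y} /\
  forall tau, 0 <= tau -> forall i : 'I_D,
    y tau ord0 i = x ord0 i
      - \int[lebesgue_measure]_(t in `[0, tau]) gradient L (y t) ord0 i.

Definition attraction_set L Gamma : set 'rV[R]_D :=
  [set x | exists (y : R -> 'rV[R]_D) (z : 'rV[R]_D),
    [/\ gradient_flow L x y, y t @[t --> +oo] --> z & Gamma z]].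

(* A family of functions (R_rho)_(rho > 0), with values in the extended reals;
   its values for rho <= 0 are never used. *)
Definition regularizer_family := R -> 'rV[R]_D -> \bar R.

Implicit Types (Rf : regularizer_family) (S : 'rV[R]_D -> R).

Definition local_inf Rf (rho r : R) x : \bar R :=
  ereal_inf [set (Rf rho x' * (rho ^- 2)%:E)%E
            | x' in [set x' | l2norm (x' - x) <= r]].

(* The inner limit always exists in \bar R, local_inf being nonincreasing in
   r. Only the values of S on Gamma matter, here and below. *)
Definition limiting_regularizer Rf Gamma S : Prop :=
  forall x, Gamma x ->
    lim (local_inf Rf rho r x @[r --> 0^'+]) @[rho --> 0^'+] --> (S x)%:E.

Definition good_around Rf Gamma S (xs : 'rV[R]_D) : Prop :=
  [/\ 0 <= S xs,
      S @ within Gamma (nbhs xs) --> S xs &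
      exists V : set 'rV[R]_D, [/\ open V, V xs &
        forall C eps : R, 0 < C -> 0 < eps ->
        exists2 rhos : R, 0 < rhos &
          forall x, Gamma x -> V x -> forall rho, 0 < rho -> rho <= rhos ->
            (`|(S x)%:E - local_inf Rf rho (C * rho) x| < eps%:E)%E]].

Definition admits_good_limiting_regularizer Rf Gamma S : Prop :=
  limiting_regularizer Rf Gamma S /\
  forall xs, Gamma xs -> good_around Rf Gamma S xs.

Definition mildly_bounded_below Rf (U : set 'rV[R]_D) : Prop :=
  forall B : set 'rV[R]_D, bounded_set B -> closed B -> B `<=` U ->
  exists2 C : R, 0 < C &
    \forall rho \near 0^'+,
      forall x, B x -> ((- (C * rho ^+ 2))%:E <= Rf rho x)%E.

End EuclideanSpace.

Arguments regularizer_family : clear implicits.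

Section TupleCons.
Context {d : measure_display} {T : measurableType d} {n : nat}.

Definition tuple_cons (p : T * n.-tuple T) : n.+1.-tuple T :=
  [tuple of p.1 :: p.2].

Lemma measurable_tuple_cons : measurable_fun [set: T * n.-tuple T] tuple_cons.
Proof. exact: measurable_cons. Qed.

HB.instance Definition _ := isMeasurableFun.Build _ _ _ _ tuple_cons
  measurable_tuple_cons.

End TupleCons.

(* N(0, I_n): the law of n independent N(0, 1) coordinates. *)
Fixpoint std_gaussian (R : realType) (n : nat) :
    probability (n.-tuple (measurableTypeR R)) R :=
  if n is m.+1 then
    distribution (normal_prob 0 1 \x std_gaussian R m)%E
      [the {mfun _ >-> _} of tuple_cons]
  else dirac [tuple].

(* E[L (x + rho g / |g|_2)] - L x for g ~ N(0, I); the null event g = 0, where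
   the library's convention gives g / |g|_2 = 0, is irrelevant. *)
Definition avg_sharpness (R : realType) (D : nat) (L : 'rV[R]_D -> R) :
    regularizer_family R D :=
  fun rho x =>
    ('E_(std_gaussian R D) [fun w : D.-tuple R =>
        let g := \row_i tnth w i in L (x + (rho / l2norm g) *: g)%R]
     - (L x)%:E)%E.

Lemma std_gaussian_rect (R : realType) (n : nat) (A : 'I_n -> set R) :
  (forall i, measurable (A i)) ->
  std_gaussian R n [set w | forall i, A i (tnth w i)] =
  (\prod_(i < n) normal_prob 0 1 (A i))%E.
Proof.
elim: n A => [|n IH] A mA.
  rewrite big_ord0 /= diracE mem_set//; by case.
rewrite big_ord_recl -IH//.
rewrite [LHS]/= /distribution /pushforward /=.
have -> : tuple_cons @^-1` [set w | forall i, A i (tnth w i)] =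
   A ord0 `*` [set w | forall i, A (lift ord0 i) (tnth w i)].
  apply/seteqP; split => [[a w] /= h|[a w] /= [h0 h] i].
    split=> [|i]; first by have := h ord0; rewrite tnth0.
    by have := h (lift ord0 i); rewrite tnthS.
  by case: (unliftP ord0 i) => [j|] ->; rewrite ?tnthS// tnth0.
rewrite product_measure1E//; first exact: mA.
have -> : [set w | forall i, A (lift ord0 i) (tnth w i)] =
    \bigcap_(i in [set: 'I_n])
      ((@tnth n (measurableTypeR R) ^~ i) @^-1` A (lift ord0 i)).
  by apply/seteqP; split => w /= h i; [move=> _|]; exact: h.
apply: fin_bigcap_measurable => // i _.
rewrite -[X in measurable X]setTI; apply: measurable_tnth => //; exact: mA.
Qed.

(* Main.v *)
From HB Require Import structures.
Require Import Defs.
From mathcomp Require Import all_boot all_order all_algebra.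
From mathcomp Require Import all_classical all_reals all_analysis.
From mathcomp Require Import fingroup perm measurable_realfun lra ring.
Import Order.TTheory GRing.Theory Num.Theory.
Import numFieldNormedType.Exports.
Local Open Scope classical_set_scope.
Local Open Scope ring_scope.
Set Implicit Arguments.
Unset Strict Implicit.
Unset Printing Implicit Defensive.

(** Write u = g / |g|.  The law of g is invariant under permutations and sign
changes of the coordinates, so E u_i = 0, E u_i u_j = 0 for i <> j, and the
E u_i^2 are equal; as they sum to 1, E u u^T = I / D.  A second-order Taylor
expansion of L at y, with the Hessian H frozen at a nearby point x, therefore
gives R_rho(y) = rho^2 (Tr H(x) / (2 D) + o(1)); since H is uniformly continuous
on bounded sets, the error is uniform for x in a bounded set and |y - x|, rho
small.  All the assertions follow from this estimate, together with Tr H >= 0 on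
Gamma, which holds because R_rho >= 0 at a local minimizer for small rho. *)

(** * The Euclidean norm and its comparison with the sup norm *)

Section L2norm.
Context {R : realType}.

Lemma l2norm_ge0 n (v : 'rV[R]_n) : 0 <= l2norm v.
Proof. exact: sqrtr_ge0. Qed.

Lemma sqr_l2norm n (v : 'rV[R]_n) : l2norm v ^+ 2 = \sum_i v ord0 i ^+ 2.
Proof. by rewrite sqr_sqrtr// sumr_ge0// => i _; rewrite sqr_ge0. Qed.

Lemma le_coord_l2norm n (v : 'rV[R]_n) i : `|v ord0 i| <= l2norm v.
Proof.
rewrite -sqrtr_sqr ler_wsqrtr// (bigD1 i)//= lerDl sumr_ge0// => j _.
exact: sqr_ge0.
Qed.

Lemma l2normZ n (a : R) (v : 'rV[R]_n) : l2norm (a *: v) = `|a| * l2norm v.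
Proof.
apply/eqP; rewrite -(@eqrXn2 _ 2) ?mulr_ge0 ?l2norm_ge0//.
rewrite exprMn !sqr_l2norm real_normK ?num_real// mulr_sumr; apply/eqP.
by apply: eq_bigr => i _; rewrite mxE exprMn.
Qed.

Lemma le_mx_norm_coord n (v : 'rV[R]_n) (M : R) : 0 <= M ->
  (forall i, `|v ord0 i| <= M) -> `|v| <= M.
Proof.
move=> M0 vM; rewrite [leLHS]/Num.norm /= mx_normrE.
apply: bigmax_le => // -[i j] _ /=; rewrite ord1; exact: vM.
Qed.

Lemma le_norm_l2norm n (v : 'rV[R]_n) : `|v| <= l2norm v.
Proof.
by apply: le_mx_norm_coord => [|i]; [exact: l2norm_ge0|exact: le_coord_l2norm].
Qed.

End L2norm.

(** * The Gaussian law: characterization on rectangles and symmetries *)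

Section StdGaussian.
Context {R : realType}.
Notation RR := (measurableTypeR R).

Lemma measurable_rectangle n (A : 'I_n -> set R) :
  (forall i, measurable (A i)) ->
  measurable [set w : n.-tuple RR | forall i, A i (tnth w i)].
Proof.
move=> mA.
have -> : [set w | forall i, A i (tnth w i)] =
    \bigcap_(i in [set: 'I_n]) ((@tnth n RR ^~ i) @^-1` A i).
  by apply/seteqP; split => w /= h i; [move=> _|]; exact: h.
apply: fin_bigcap_measurable => // i _.
by rewrite -[X in measurable X]setTI; apply: measurable_tnth => //; exact: mA.
Qed.

(** Rectangles form a pi-system generating the product sigma-algebra, so their masses determine the
    law. Invariance of the law is proved through this. *)
Lemma std_gaussian_unique n (m : {measure set (n.-tuple RR) -> \bar R}) :
  (forall A : 'I_n -> set R, (forall i, measurable (A i)) ->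
     m [set w | forall i, A i (tnth w i)] =
     (\prod_(i < n) normal_prob 0 1 (A i))%E) ->
  forall B, measurable B -> std_gaussian R n B = m B.
Proof.
move=> mE B mB; apply/esym.
pose G := [set C : set (n.-tuple RR) | exists A : 'I_n -> set R,
  (forall i, measurable (A i)) /\ C = [set w | forall i, A i (tnth w i)]].
have GT : G setT by exists (fun=> setT); split=> //; apply/seteqP; split.
apply: (measure_unique G (fun=> setT)) => //.
- apply/seteqP; split; last first.
    apply: smallest_sub; first exact: sigma_algebra_measurable.
    by move=> _ [A [mA ->]]; exact: measurable_rectangle.
  (* The product sigma-algebra is generated by preimages under single coordinates; such a preimage
     is a rectangle whose other sides are [setT]. *)
  apply: (@smallest_sub _ (sigma_algebra setT) _ <<s G >>).
    exact: smallest_sigma_algebra.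
  rewrite -bigcup_seq; apply: bigcup_sub => i _ _ [A mA <-].
  rewrite setTI; apply: (@sub_sigma_algebra _ setT G).
  exists (fun j => if j == i then A else setT); split=> [j|].
    by case: ifP.
  apply/seteqP; split => w /= h => [j|]; last by have := h i; rewrite eqxx.
  by case: ifPn => // /eqP ->.
- move=> _ _ [A [mA ->]] [C [mC ->]]; exists (fun i => A i `&` C i); split.
    by move=> i; exact: measurableI.
  apply/seteqP; split => w /=; first by move=> [h1 h2] i; split.
  by move=> h; split => i; have [] := h i.
- by apply/seteqP; split=> // x _; exists 0%N.
- move=> _ [A [mA ->]]; exact: etrans (mE A mA) (esym (std_gaussian_rect mA)).
- move=> _; have := mE (fun=> setT) (fun=> measurableT).
  rewrite (_ : [set w | _] = setT); last by apply/seteqP; split.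
  move=> ->; rewrite big1 ?ltry// => i _; exact: probability_setT.
Qed.

(** The density is even and Lebesgue measure is invariant under reflection. *)
Lemma normal_probN (A : set R) : measurable A ->
  normal_prob 0 1 (-%R @^-1` A) = normal_prob 0 1 A :> \bar R.
Proof.
move=> mA; rewrite /normal_prob.
have mN : measurable_fun setT (-%R : RR -> RR) by [].
transitivity (\int[pushforward lebesgue_measure (-%R : RR -> RR)]_(x in A)
    (normal_pdf 0 1 x)%:E)%E; last first.
  by apply: eq_measure_integral => B mB _; exact: lebesgue_measureN.
rewrite ge0_integral_pushforward//; last 2 first.
- apply/measurable_EFinP; apply: measurable_funTS.
  exact: measurable_normal_pdf.
- by move=> x _; rewrite lee_fin normal_pdf_ge0.
apply: eq_integral => x _ /=; congr EFin.
by rewrite !normal_pdfE ?oner_eq0//= /normal_fun !subr0 sqrrN.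
Qed.

Lemma normal_prob_set1 (x : R) : normal_prob 0 1 [set x] = 0%E :> \bar R.
Proof.
have /null_content_dominatesP := @normal_prob_dominates R 0 1.
by apply; [exact: measurable_set1|exact: lebesgue_measure_set1].
Qed.

Definition signed_perm n (e : 'I_n -> bool) (s : {perm 'I_n})
    (w : n.-tuple RR) : n.-tuple RR :=
  [tuple (-1) ^+ e i * tnth w (s i) | i < n].

Lemma measurable_signed_perm n (e : 'I_n -> bool) (s : {perm 'I_n}) :
  measurable_fun setT (signed_perm e s).
Proof.
apply/measurable_fun_tnthP => i; rewrite /comp /signed_perm.
under eq_fun do rewrite tnth_mktuple.
by apply: measurable_funM => //; exact: measurable_tnth.
Qed.

HB.instance Definition _ n (e : 'I_n -> bool) (s : {perm 'I_n}) :=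
  isMeasurableFun.Build _ _ _ _ (signed_perm e s) (measurable_signed_perm e s).

(** The preimage of a rectangle is a rectangle with permuted and possibly reflected sides, so the
    product of the one-dimensional masses does not change. *)
Lemma std_gaussian_signed_perm n (e : 'I_n -> bool) (s : {perm 'I_n}) B :
  measurable B ->
  std_gaussian R n B = pushforward (std_gaussian R n) (signed_perm e s) B.
Proof.
move=> mB.
apply: (@std_gaussian_unique n (distribution (std_gaussian R n)
  [the {mfun _ >-> _} of signed_perm e s])) mB => A mA.
rewrite /distribution /pushforward /=.
(* Coordinate [i] of [w] lands in position [s^-1 i] of the image, hence is constrained by the side
   with that index, reflected when the sign there is negative. *)
pose A' i :=
  if e ((s^-1)%g i) then -%R @^-1` A ((s^-1)%g i) else A ((s^-1)%g i).
have mA' i : measurable (A' i).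
  rewrite /A'; case: ifP => // _; rewrite -[X in measurable X]setTI.
  exact: oppr_measurable.
transitivity (std_gaussian R n [set w | forall i, A' i (tnth w i)]).
  congr (std_gaussian R n _); apply/seteqP; split => w /= Aw i.
    have := Aw ((s^-1)%g i); rewrite tnth_mktuple permKV /A'.
    by case: ifP => _ /=; rewrite ?expr1 ?expr0 ?mulN1r ?mul1r.
  have := Aw (s i); rewrite tnth_mktuple /A' permK.
  by case: (e i) => /=; rewrite ?expr1 ?expr0 ?mulN1r ?mul1r.
apply: etrans (std_gaussian_rect mA') _.
rewrite (reindex_inj (@perm_inj _ s)) /=; apply: eq_bigr => i _.
by rewrite /A' permK; case: (e i) => //; exact: normal_probN.
Qed.

(** * The normalized direction: measurability, bounds, equivariance *)

(* On the null event w = 0 this is 0, since 0^-1 = 0. *)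
Definition direction n (w : n.-tuple RR) (i : 'I_n) : R :=
  tnth w i / l2norm (\row_j tnth w j).

Lemma scaled_coordE n (w : n.-tuple RR) (rho : R) i :
  ((rho / l2norm (\row_j tnth w j)) *: (\row_j tnth w j) : 'rV[R]_n) ord0 i =
  rho * direction w i.
Proof. by rewrite !mxE /direction mulrAC mulrA. Qed.

Lemma measurable_direction n i : measurable_fun setT (@direction n ^~ i).
Proof.
apply: measurable_funM; first exact: measurable_tnth.
(* Inversion is not continuous at 0, but on nonnegative reals it agrees with the power [-1], also at
   0, and real powers are measurable. *)
have -> : (fun w : n.-tuple RR => (l2norm (\row_j tnth w j))^-1) =
    (@powR R ^~ (-1)) \o (@Num.sqrt R) \o
      (fun w : n.-tuple RR => \sum_j tnth w j ^+ 2).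
  apply/funext => w /=; rewrite powR_inv1 ?sqrtr_ge0//.
  by congr (Num.sqrt _)^-1; apply: eq_bigr => j _; rewrite mxE.
apply: measurableT_comp.
  apply: measurableT_comp; first exact: measurable_powR.
  by apply: continuous_measurable_fun; exact: sqrt_continuous.
apply: measurable_sum => j; apply: measurable_funX; exact: measurable_tnth.
Qed.

Lemma direction_le1 n (w : n.-tuple RR) i : `|direction w i| <= 1.
Proof.
rewrite normrM normfV (ger0_norm (l2norm_ge0 _)).
have [->|w0] := eqVneq (l2norm (\row_j tnth w j)) 0.
  by rewrite invr0 mulr0.
rewrite ler_pdivrMr ?lt_neqAle ?l2norm_ge0 1?eq_sym ?w0// mul1r.
by have := le_coord_l2norm (\row_j tnth w j) i; rewrite mxE.
Qed.

(** A signed permutation preserves the Euclidean norm, so normalizing commutes with it. *)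
Lemma direction_signed_perm n e s (w : n.-tuple RR) i :
  direction (signed_perm e s w) i = (-1) ^+ e i * direction w (s i).
Proof.
rewrite /direction tnth_mktuple mulrA; congr (_ / Num.sqrt _).
rewrite [RHS](reindex_inj (@perm_inj _ s)); apply: eq_bigr => j _.
by rewrite !mxE tnth_mktuple exprMn sqrr_sign mul1r.
Qed.

Lemma sum_sqr_direction n (w : n.-tuple RR) :
  l2norm (\row_j tnth w j) != 0 -> \sum_i direction w i ^+ 2 = 1.
Proof.
move=> w0; under eq_bigr do rewrite expr_div_n.
rewrite -mulr_suml sqr_l2norm; under [X in _ / X]eq_bigr do rewrite mxE.
rewrite divff//; move: w0; rewrite -sqrf_eq0 sqr_l2norm.
by under eq_bigr do rewrite mxE.
Qed.

Lemma integrable_bounded_gaussian n (f : n.-tuple RR -> R) (M : R) :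
  measurable_fun setT f -> (forall w, `|f w| <= M) ->
  (std_gaussian R n).-integrable setT (EFin \o f).
Proof.
move=> mf fM; apply: measurable_bounded_integrable => //.
  by have := ltry (1 : R); rewrite -(probability_setT (std_gaussian R n)).
by exists M; split; [exact: num_real|move=> x xM w _; exact: le_trans (ltW xM)].
Qed.

(** Change of variables under an invariant law; the bound [M] supplies the integrability that the
    pushforward formula requires. *)
Lemma Rintegral_signed_perm n e s (f : n.-tuple RR -> R) (M : R) :
  measurable_fun setT f -> (forall w, `|f w| <= M) ->
  \int[std_gaussian R n]_w f (signed_perm e s w) = \int[std_gaussian R n]_w f w.
Proof.
move=> mf fM; rewrite /Rintegral; congr fine.
transitivity
  (\int[pushforward (std_gaussian R n) (signed_perm e s)]_w (f w)%:E)%E.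
  rewrite integral_pushforward//.
  - exact/measurable_EFinP.
  - apply: (@integrable_bounded_gaussian _ _ M) => [|w]; last exact: fM.
    by apply: measurableT_comp => //; exact: measurable_signed_perm.
apply: eq_measure_integral => B mB _.
by rewrite [RHS](std_gaussian_signed_perm e s).
Qed.

(** * First and second moments of the direction *)

Lemma measurable_direction2 n i j :
  measurable_fun setT (fun w => @direction n w i * direction w j).
Proof. by apply: measurable_funM; exact: measurable_direction. Qed.

Lemma direction2_le1 n (w : n.-tuple RR) i j :
  `|direction w i * direction w j| <= 1.
Proof. by rewrite normrM mulr_ile1// direction_le1. Qed.

Let integrable_direction n i :
  (std_gaussian R n).-integrable setT (EFin \o (fun w => direction w i)).
Proof.
apply: (@integrable_bounded_gaussian _ _ 1); first exact: measurable_direction.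
by move=> w; exact: direction_le1.
Qed.

Let integrable_direction2 n i j :
  (std_gaussian R n).-integrable setT
    (EFin \o (fun w => direction w i * direction w j)).
Proof.
apply: (@integrable_bounded_gaussian _ _ 1); first exact: measurable_direction2.
by move=> w; exact: direction2_le1.
Qed.

(** Flipping all signs turns the integral into its opposite. *)
Lemma Rintegral_direction n i :
  \int[std_gaussian R n]_w direction w i = 0.
Proof.
have := @Rintegral_signed_perm n (fun=> true) 1%g (fun w => direction w i) 1
  (@measurable_direction _ i) (fun w => direction_le1 w i).
under eq_Rintegral do rewrite direction_signed_perm perm1 expr1.
by rewrite RintegralZl//; lra.
Qed.

(** Flipping the sign of coordinate [i] alone negates the product, since [j] differs from [i]. *)
Lemma Rintegral_direction_offdiag n i j : i != j ->
  \int[std_gaussian R n]_w (direction w i * direction w j) = 0.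
Proof.
move=> ij; have := @Rintegral_signed_perm n (pred1 i) 1%g
  (fun w => direction w i * direction w j) 1
  (@measurable_direction2 _ i j) (fun w => direction2_le1 w i j).
under eq_Rintegral do rewrite !direction_signed_perm !perm1 /= eqxx eq_sym
  (negbTE ij) expr1 expr0 mul1r -mulrA.
by rewrite RintegralZl//; lra.
Qed.

(** Transpositions make the [n] diagonal moments equal, and they sum to 1 because the squares sum to
    1 almost surely. *)
Lemma Rintegral_direction_diag n i :
  \int[std_gaussian R n]_w (direction w i * direction w i) = n%:R^-1.
Proof.
have eqE j : \int[std_gaussian R n]_w (direction w j * direction w j) =
    \int[std_gaussian R n]_w (direction w i * direction w i).
  rewrite -(@Rintegral_signed_perm n (fun=> false) (tperm i j)
    (fun w => direction w j * direction w j) 1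
    (@measurable_direction2 _ j j) (fun w => direction2_le1 w j j)).
  by under eq_Rintegral do rewrite !direction_signed_perm tpermR expr0 mul1r.
have n0 : n%:R != 0 :> R by rewrite pnatr_eq0; case: (n) i {eqE} => // -[].
have : \sum_j \int[std_gaussian R n]_w (direction w j * direction w j) = 1.
  apply: EFin_inj; rewrite -sumEFin.
  have intE j : (\int[std_gaussian R n]_w (direction w j * direction w j))%:E =
      (\int[std_gaussian R n]_w (direction w j * direction w j)%:E)%E.
    rewrite fineK//; apply: integrable_fin_num => //.
    exact: integrable_direction2.
  under eq_bigr do rewrite intE.
  rewrite -integral_sum//; last by move=> j; exact: integrable_direction2.
  transitivity (\int[std_gaussian R n]_w (cst 1%E) w)%E; last first.
    by rewrite integral_cst// mul1e; exact: probability_setT.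
  apply: ae_eq_integral => //.
    apply: emeasurable_sum => j; apply/measurable_EFinP.
    exact: measurable_direction2.
  (* The exceptional set is the origin, written as a rectangle so that its mass is a product of
     zeros. *)
  pose N := [set w : n.-tuple RR | forall i, [set (0 : R)] (tnth w i)].
  exists N; split.
  - exact: (@measurable_rectangle _ (fun=> [set 0]) (fun=> measurable_set1 0)).
  - apply: etrans
      (@std_gaussian_rect R n (fun=> [set 0]) (fun=> measurable_set1 0)) _.
    by rewrite (bigD1 i)//= normal_prob_set1 mul0e.
  - move=> w /= h k; apply: contrapT => wk; apply: h => _; rewrite sumEFin.
    congr EFin; rewrite -[RHS](@sum_sqr_direction _ w).
      by apply: eq_bigr => j _; rewrite expr2.
    have := le_coord_l2norm (\row_j tnth w j) k; rewrite mxE.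
    by apply: contraTneq => ->; rewrite normr_le0; apply/eqP.
under eq_bigr do rewrite eqE.
rewrite sumr_const card_ord => h.
by rewrite -[LHS](mulKf n0) mulr_natl h mulr1.
Qed.

(** * Expectation of a quadratic polynomial in the direction *)

Section Quadratic.
Variables (n : nat) (c : R) (a : 'I_n -> R) (b : 'I_n -> 'I_n -> R).
Let P := std_gaussian R n.

Let intc : P.-integrable setT (EFin \o fun=> c).
Proof. by apply: (@integrable_bounded_gaussian _ _ `|c|). Qed.

Let inta i : P.-integrable setT (EFin \o fun w => a i * direction w i).
Proof. exact: (integrableZl measurableT (a i) (integrable_direction i)). Qed.

Let intb i j :
  P.-integrable setT (EFin \o fun w => b i j * (direction w i * direction w j)).
Proof.
exact: (integrableZl measurableT (b i j) (integrable_direction2 i j)).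
Qed.

Let integrable_EFin_sum (I : finType) (f : I -> n.-tuple RR -> R) :
  (forall i, P.-integrable setT (EFin \o f i)) ->
  P.-integrable setT (EFin \o fun w => \sum_i f i w).
Proof.
move=> fi; rewrite (_ : _ \o _ = fun w => \sum_i (f i w)%:E)%E.
  by apply: integrable_sum => // i _; exact: fi.
by apply/funext => w /=; rewrite sumEFin.
Qed.

Let Rintegral_sum (I : finType) (f : I -> n.-tuple RR -> R) :
  (forall i, P.-integrable setT (EFin \o f i)) ->
  \int[P]_w (\sum_i f i w) = \sum_i \int[P]_w f i w.
Proof.
move=> fi; apply: EFin_inj; rewrite -sumEFin fineK; last first.
  by apply: integrable_fin_num => //; exact: integrable_EFin_sum.
under eq_integral do rewrite -sumEFin.
rewrite integral_sum//; apply: eq_bigr => i _.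
by rewrite fineK//; apply: integrable_fin_num => //; exact: fi.
Qed.

(** By the moment formulas the linear and off-diagonal terms vanish and each diagonal term
    contributes [b i i / n]. *)
Lemma integral_direction_quadratic :
  (\int[P]_w
    (c + \sum_i a i * direction w i +
     \sum_i \sum_j b i j * (direction w i * direction w j))%:E)%E =
  (c + (\sum_i b i i) / n%:R)%:E.
Proof.
have ia := integrable_EFin_sum inta.
have ib i := integrable_EFin_sum (intb i).
have ibb := integrable_EFin_sum ib.
have ica : P.-integrable setT
    (EFin \o fun w => c + \sum_i a i * direction w i).
  exact: (integrableD measurableT intc ia).
rewrite -[LHS]fineK; last first.
  by apply: integrable_fin_num => //; exact: (integrableD measurableT ica ibb).
congr EFin; rewrite -/(Rintegral _ _ _) RintegralD// RintegralD//.
rewrite Rintegral_cst// Rintegral_sum// big1 => [|i _]; last first.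
  by rewrite RintegralZl// Rintegral_direction mulr0.
rewrite Rintegral_sum// addr0; congr (_ + _).
  rewrite -[RHS]mulr1; congr (_ * _).
  exact: (congr1 fine (probability_setT P)).
rewrite mulr_suml; apply: eq_bigr => i _.
rewrite Rintegral_sum// (bigD1 i)//= big1 => [|j ji]; last first.
  by rewrite RintegralZl// Rintegral_direction_offdiag ?mulr0// eq_sym.
by rewrite addr0 RintegralZl// Rintegral_direction_diag.
Qed.

End Quadratic.

End StdGaussian.

(* Stated without measurability, so that w |-> L (x + rho *: w / |w|) need not
   be shown measurable for the product sigma-algebra. *)
Lemma le_integral_pointwise d (T : measurableType d) (R : realType)
    (mu : {measure set T -> \bar R}) (f g : T -> \bar R) :
  (forall x, f x <= g x)%E -> (\int[mu]_x f x <= \int[mu]_x g x)%E.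
Proof.
(* For nonnegative functions the integral is a supremum over simple functions below, which is
   monotone by inclusion; the general case splits into positive and negative parts. *)
move=> fg; have ge0 (h k : T -> \bar R) : (forall x, 0 <= h x)%E ->
    (forall x, h x <= k x)%E -> (\int[mu]_x h x <= \int[mu]_x k x)%E.
  move=> h0 hk; rewrite !ge0_integralTE//; last first.
    by move=> x; exact: le_trans (h0 x) (hk x).
  apply: ereal_sup_le => _ [s /= sh <-]; exists s => //= x.
  exact: le_trans (sh x) (hk x).
rewrite integralE [leRHS]integralE; apply: leeB; apply: ge0 => // x.
  by rewrite !funeposE ge_max !le_max fg lexx !orbT.
by rewrite !funenegE ge_max !le_max leeN2 fg lexx !orbT.
Qed.

(** * Uniform continuity on balls and second-order Taylor expansion *)

Section Euclid.
Context {R : realType} {D : nat}.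
Implicit Types (L f : 'rV[R]_D -> R) (x y v : 'rV[R]_D).

Lemma compact_sup_ball (M : R) : compact [set x : 'rV[R]_D | `|x| <= M].
Proof.
apply: bounded_closed_compact.
  exists M; split; first exact: num_real.
  by move=> N MN x /= xM; exact: le_trans (ltW MN).
apply: (@closed_comp _ _ (fun x => `|x|) [set r | r <= M]).
  by move=> x _; exact: norm_continuous.
exact: closed_le.
Qed.

(** Heine-Cantor, by compactness of the ball; [y] may leave the ball, which suits points near its
    boundary. *)
Lemma uniformly_continuous_on_ball f (M e : R) : continuous f -> 0 < e ->
  exists2 d, 0 < d &
    forall x y, `|x| <= M -> `|y - x| < d -> `|f y - f x| < e.
Proof.
move=> cf e0.
have /compact_near_coveringP := @compact_sup_ball M.
move=> /(_ R (0^'+) (fun d x => forall y, `|y - x| < d -> `|f y - f x| < e)).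
move=> [|d /= d0 Hd].
  move=> x _; have /cvgrPdist_lt /(_ (e / 2)) := cf x.
  rewrite divr_gt0// => /(_ isT) /nbhs_normP[r /= r0 Hr].
  (* If [z] is within [r / 2] of the centre and [y] within [d < r / 2] of [z], both are within [r]
     of the centre, so both values are [e / 2]-close to the value there. *)
  exists (ball x (r / 2), [set d : R | 0 < d < r / 2]).
    split; first by apply: nbhsx_ballx; rewrite divr_gt0.
    near=> d; apply/andP; split; near: d; first exact: nbhs_right_gt.
    by apply: nbhs_right_lt; rewrite divr_gt0.
  move=> [z d] /= [xz /andP[d0 dr]] y yz.
  move: xz; rewrite -ball_normE /= => xz.
  have xz' : `|x - z| < r by apply: lt_trans xz _; rewrite ltr_pdivrMr//; lra.
  have xy : `|x - y| < r.
    rewrite -(subrK z x) -addrA (le_lt_trans (ler_normD _ _))//.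
    by rewrite (splitr r) ltrD// distrC (lt_trans yz).
  have := Hr _ xz'; have := Hr _ xy; rewrite /= => h1 h2.
  rewrite -(subrK (f x) (f y)) -addrA (le_lt_trans (ler_normD _ _))//.
  by rewrite (splitr e) ltrD// distrC.
exists (d / 2); first by rewrite divr_gt0.
move=> x y xM yx; apply: (Hd (d / 2)) yx => //=; last by rewrite divr_gt0.
  by rewrite sub0r normrN gtr0_norm ?divr_gt0// ltr_pdivrMr//; lra.
Unshelve. all: by end_near. Qed.

Lemma bounded_on_ball f (M : R) : continuous f ->
  exists C, forall x, `|x| <= M -> `|f x| <= C.
Proof.
move=> cf.
have [C [_ HC]] : bounded_set (f @` [set x | `|x| <= M]).
  apply/compact_bounded/continuous_compact; last exact: compact_sup_ball.
  exact: continuous_subspaceT.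
by exists (C + 1) => x xM; apply: HC; [rewrite ltrDl|exists x].
Qed.

Lemma is_derive_line f x v (t : R) : differentiable f (x + t *: v) ->
  is_derive t 1 (fun s : R => f (x + s *: v)) ('D_v f (x + t *: v)).
Proof.
move=> df.
have E : (fun h : R => h^-1 *: (f (x + (h *: 1 + t) *: v) - f (x + t *: v))) =
    (fun h : R => h^-1 *: (f (h *: v + (x + t *: v)) - f (x + t *: v))).
  apply/funext => h; congr (_ *: (f _ - _)).
  by rewrite [h *: 1]mulr1 scalerDl addrCA.
have dv : derivable f (x + t *: v) v by exact: diff_derivable.
apply: DeriveDef; first by rewrite /derivable /= E.
by rewrite /derive /= E.
Qed.

Lemma derive_coord f x v : differentiable f x ->
  'D_v f x = \sum_i v ord0 i * 'D_(basis_vec i) f x.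
Proof.
move=> df; rewrite deriveE// {1}(row_sum_delta v) linear_sum.
by apply: eq_bigr => i _; rewrite linearZ /= deriveE.
Qed.

(** The mean value theorem, applied to [p] minus its quadratic model and then to the derivative,
    writes the remainder as [(p2 d - A) * c] with [0 <= c <= 1]. *)
Lemma taylor2_real (p p1 p2 : R -> R) (A e : R) :
  (forall t : R, is_derive t 1 p (p1 t)) ->
  (forall t : R, is_derive t 1 p1 (p2 t)) ->
  (forall t : R, 0 <= t <= 1 -> `|p2 t - A| <= e) ->
  `|p 1 - (p 0 + p1 0 + A / 2)| <= e.
Proof.
move=> dp dp1 He.
pose q t := p t - (p1 0 * t + A / 2 * t ^+ 2).
pose q1 t := p1 t - A * t.
have dq (t : R) : is_derive t 1 q (q1 t - q1 0).
  rewrite /q; apply: is_derive_eq.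
  by rewrite /q1 /GRing.scale /=; field.
have dq1 (t : R) : is_derive t 1 q1 (p2 t - A).
  rewrite /q1; apply: is_derive_eq.
  by rewrite /GRing.scale /=; ring.
have cont (h h' : R -> R) (hh' : forall t : R, is_derive t 1 h (h' t)) :
    continuous h.
  move=> t; apply/differentiable_continuous/derivable1_diffP.
  by have := hh' t => -[].
have [c c01 qc] := @MVT_segment R q (fun t => q1 t - q1 0) 0 1 ler01
  (fun t _ => dq t) (continuous_subspaceT (cont _ _ dq)).
move: c01; rewrite in_itv /= => /andP[c0 c1].
have [d dc q1d] := @MVT_segment R q1 (fun t => p2 t - A) 0 c c0
  (fun t _ => dq1 t) (continuous_subspaceT (cont _ _ dq1)).
move: dc; rewrite in_itv /= => /andP[d0 dc].
have -> : p 1 - (p 0 + p1 0 + A / 2) = (p2 d - A) * c.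
  rewrite subr0 in q1d; rewrite -q1d subr0 mulr1 in qc *.
  by rewrite -qc /q; ring.
rewrite normrM (ger0_norm c0).
have h := He d _; apply: le_trans (ler_pM _ _ (h _) c1) _ => //.
  by rewrite d0 (le_trans dc).
by rewrite mulr1.
Qed.

Lemma Ck_onW (V W : normedModType R) k (U : set V) (f : V -> W) :
  Ck_on k.+1 U f -> Ck_on k U f.
Proof.
elim: k f => [|k IHk] f [df Df] => [x Ux|].
  exact/differentiable_continuous/df.
by split=> // v; apply: IHk; exact: Df.
Qed.

Lemma hessian_continuous L i j :
  Ck_on 2 setT L -> continuous (fun x => hessian L x i j).
Proof.
move=> [_ /(_ (basis_vec i))[_ /(_ (basis_vec j)) cH]] x.
rewrite (_ : (fun x => _) = 'D_(basis_vec j) ('D_(basis_vec i) L)).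
  exact: cH.
by apply/funext => z; rewrite mxE.
Qed.

(** The one-variable expansion along [t |-> y + t v]. The matrix [B] replaces the Hessian at a cost
    of at most [r ^+ 2 * e] for each of the [D ^ 2] entries. *)
Lemma taylor2_hessian L (B : 'M[R]_D) y v (r e : R) :
  Ck_on 2 setT L -> (forall i, `|v ord0 i| <= r) ->
  (forall z i j, `|z - y| <= r -> `|hessian L z i j - B i j| <= e) ->
  `|L (y + v) - (L y + \sum_i v ord0 i * 'D_(basis_vec i) L y +
      (\sum_i \sum_j B i j * (v ord0 i * v ord0 j)) / 2)|
    <= D%:R ^+ 2 * (r ^+ 2 * e).
Proof.
move=> [dL dDL] vr HB.
pose p (t : R) := L (y + t *: v).
pose p1 (t : R) := \sum_i v ord0 i * 'D_(basis_vec i) L (y + t *: v).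
pose p2 (t : R) :=
  \sum_i v ord0 i * \sum_j v ord0 j * hessian L (y + t *: v) i j.
have dp (t : R) : is_derive t 1 p (p1 t).
  by rewrite /p1 -derive_coord; [apply: is_derive_line|]; exact: dL.
have dp1 (t : R) : is_derive t 1 p1 (p2 t).
  rewrite (_ : p1 = \sum_i (v ord0 i *:
      (fun t : R => 'D_(basis_vec i) L (y + t *: v)))).
    apply: is_derive_sum => i; apply: is_deriveZ.
    have [dDi _] := dDL (basis_vec i).
    under eq_bigr do rewrite mxE.
    rewrite -derive_coord; last exact: dDi.
    by apply: is_derive_line; exact: dDi.
  by apply/funext => s; rewrite fct_sumE.
have := @taylor2_real p p1 p2 (\sum_i \sum_j B i j * (v ord0 i * v ord0 j))
  (D%:R ^+ 2 * (r ^+ 2 * e)) dp dp1.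
rewrite /p /p1 scale1r scale0r addr0; apply => t /andP[t0 t1].
(* For [D = 0] there is no coordinate from which to deduce [0 <= r]; both sides are then 0. *)
case: (posnP D) => [D0|D0].
  have noI (i : 'I_D) : False by case: i => m; rewrite D0.
  rewrite /p2 !big1 => [|i _|i _]; try by case: (noI i).
  by rewrite subrr normr0 D0 expr0n mul0r.
have r0 : 0 <= r by exact: le_trans (normr_ge0 _) (vr (Ordinal D0)).
have zy : `|y + t *: v - y| <= r.
  rewrite addrAC subrr add0r; apply: le_mx_norm_coord => // i.
  by rewrite mxE normrM (ger0_norm t0) (le_trans (ler_piMl _ _))// vr.
rewrite /p2 -sumrB.
under eq_bigr do rewrite mulr_sumr -sumrB.
have -> : D%:R ^+ 2 * (r ^+ 2 * e) = \sum_(i < D) \sum_(j < D) r ^+ 2 * e.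
  under eq_bigr do rewrite sumr_const card_ord.
  by rewrite sumr_const card_ord -mulrnA -[RHS]mulr_natl natrM -expr2.
apply: le_trans (ler_norm_sum _ _ _) _; apply: ler_sum => i _.
apply: le_trans (ler_norm_sum _ _ _) _; apply: ler_sum => j _.
set h := hessian _ _ _ _.
have -> : v ord0 i * (v ord0 j * h) - B i j * (v ord0 i * v ord0 j) =
  (v ord0 i * v ord0 j) * (h - B i j) by ring.
by rewrite !normrM ler_pM ?mulr_ge0 ?HB// expr2 ler_pM.
Qed.

(** Average the Taylor bounds over the direction: the gradient term disappears and the quadratic
    form becomes its trace over [2 * D]. *)
Lemma avg_sharpness_bounds L (B : 'M[R]_D) y (rho e : R) :
  Ck_on 2 setT L -> 0 < rho ->
  (forall z i j, `|z - y| <= rho -> `|hessian L z i j - B i j| <= e) ->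
  ((rho ^+ 2 * (\tr B / (2 * D%:R) - D%:R ^+ 2 * e))%:E
     <= avg_sharpness L rho y
     <= (rho ^+ 2 * (\tr B / (2 * D%:R) + D%:R ^+ 2 * e))%:E)%E.
Proof.
move=> hL rho0 HB.
have rhoge0 := ltW rho0.
pose E := D%:R ^+ 2 * (rho ^+ 2 * e).
pose a i := rho * 'D_(basis_vec i) L y.
pose b i j := rho ^+ 2 / 2 * B i j.
(* The Taylor polynomial with free constant term: taking [L y - E] and [L y + E] for [c] absorbs the
   error, so one integral formula gives both bounds. *)
pose q (c : R) (w : D.-tuple (measurableTypeR R)) :=
  c + \sum_i a i * direction w i +
  \sum_i \sum_j b i j * (direction w i * direction w j).
have intq c : (\int[std_gaussian R D]_w (q c w)%:E)%E =
    (c + rho ^+ 2 * (\tr B / (2 * D%:R)))%:E.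
  rewrite integral_direction_quadratic; congr (_ + _)%:E.
  by rewrite -mulr_sumr -/(\tr B) invfM; ring.
pose F (w : D.-tuple (measurableTypeR R)) :=
  L (y + (rho / l2norm (\row_i tnth w i)) *: (\row_i tnth w i)).
have Fq w : q (L y - E) w <= F w <= q (L y + E) w.
  set v := (rho / l2norm (\row_i tnth w i)) *: (\row_i tnth w i).
  have vE i : v ord0 i = rho * direction w i by rewrite /v scaled_coordE.
  have vr i : `|v ord0 i| <= rho.
    by rewrite vE normrM (gtr0_norm rho0) ler_piMr// direction_le1.
  have := taylor2_hessian hL vr HB.
  have -> : \sum_i v ord0 i * 'D_(basis_vec i) L y = \sum_i a i * direction w i.
    by apply: eq_bigr => i _; rewrite vE /a mulrAC.
  have -> : (\sum_i \sum_j B i j * (v ord0 i * v ord0 j)) / 2 =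
      \sum_i \sum_j b i j * (direction w i * direction w j).
    rewrite mulr_suml; apply: eq_bigr => i _; rewrite mulr_suml.
    by apply: eq_bigr => j _; rewrite !vE /b; ring.
  by rewrite -/(F w) -/E ler_norml /q; lra.
rewrite /avg_sharpness unlock -/F.
have <- : (L y - E + rho ^+ 2 * (\tr B / (2 * D%:R)) - L y) =
   rho ^+ 2 * (\tr B / (2 * D%:R) - D%:R ^+ 2 * e) by rewrite /E; ring.
have <- : (L y + E + rho ^+ 2 * (\tr B / (2 * D%:R)) - L y) =
   rho ^+ 2 * (\tr B / (2 * D%:R) + D%:R ^+ 2 * e) by rewrite /E; ring.
rewrite !EFinB; apply/andP; split; apply: leeB => //; rewrite -intq;
  apply: le_integral_pointwise => w; rewrite lee_fin; by have /andP[] := Fq w.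
Qed.

End Euclid.

(** * The uniform estimate for the average-direction sharpness and local infima *)

Section AvgSharpness.
Context {R : realType} {D : nat}.
Implicit Types (L : 'rV[R]_D -> R) (x y : 'rV[R]_D).

Lemma avg_sharpness_ge0 L x (rho : R) : 0 < rho ->
  (forall z, `|z - x| <= rho -> L x <= L z) -> (0 <= avg_sharpness L rho x)%E.
Proof.
move=> rho0 Lx; rewrite /avg_sharpness unlock sube_ge0//.
rewrite -[leLHS](_ : (\int[std_gaussian R D]_w (cst (L x)%:E) w)%E = _).
  apply: le_integral_pointwise => w; rewrite lee_fin /=; apply: Lx.
  rewrite addrAC subrr add0r; apply: le_mx_norm_coord; first exact: ltW.
  move=> i; rewrite scaled_coordE normrM (gtr0_norm rho0).
  by rewrite ler_piMr ?(ltW rho0)// direction_le1.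
by rewrite integral_cst// -[RHS]mule1; congr mule; exact: probability_setT.
Qed.

Definition half_mean_trace L x : R := \tr (hessian L x) / (2 * D%:R).

Lemma half_mean_trace_continuous L :
  Ck_on 2 setT L -> continuous (half_mean_trace L).
Proof.
move=> hL x.
have h : \tr (hessian L y) @[y --> x] --> \tr (hessian L x).
  rewrite /mxtrace; refine (@cvg_big R _ +%R 0 xpredT
    (fun z => add_continuous z) _ (nbhs x) _ _ _ _ _) => i _.
  exact: hessian_continuous.
exact: cvgMr_tmp h.
Qed.

(** The central estimate: the trace is taken at [x] while the sharpness is evaluated at any nearby
    [y], as needed for infima over balls around [x]. *)
Lemma avg_sharpness_uniform L (M e : R) : Ck_on 2 setT L -> 0 < e ->
  exists2 d, 0 < d & forall x y rho,
    `|x| <= M -> `|y - x| <= d -> 0 < rho -> rho <= d ->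
    ((rho ^+ 2 * (half_mean_trace L x - e))%:E <= avg_sharpness L rho y
      <= (rho ^+ 2 * (half_mean_trace L x + e))%:E)%E.
Proof.
(* The added 1 keeps the denominator positive when [D = 0], and still [D ^ 2 * e' <= e]. *)
move=> hL e0; pose e' := e / (D%:R ^+ 2 + 1).
have D1 : 0 < D%:R ^+ 2 + 1 :> R by rewrite ltr_wpDl// sqr_ge0.
have e'0 : 0 < e' by rewrite divr_gt0.
have De : D%:R ^+ 2 * e' <= e.
  by rewrite /e' mulrA ler_pdivrMr// mulrDr mulr1 mulrC lerDl ltW.
have : \forall d \near (0 : R)^'+, forall i j x y, `|x| <= M -> `|y - x| < d ->
    `|hessian L y i j - hessian L x i j| < e'.
  apply: filter_forall => i; apply: filter_forall => j.
  have [d d0 Hd] := uniformly_continuous_on_ball M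
    (hessian_continuous (i := i) (j := j) hL) e'0.
  near=> d' => x y xM yx; apply: Hd => //; apply: lt_le_trans yx _.
  by near: d'; exact: nbhs_right_le.
move=> nearH; near (0 : R)^'+ => d0.
have d00 : 0 < d0 by [].
have Hd : forall i j x y, `|x| <= M -> `|y - x| < d0 ->
    `|hessian L y i j - hessian L x i j| < e' by near: d0.
(* A point [z] within [rho] of [y] is within [2 * d0 / 3 < d0] of [x]. *)
exists (d0 / 3) => [|x y rho xM yx rho0 rhod]; first by rewrite divr_gt0.
have HB z i j : `|z - y| <= rho -> `|hessian L z i j - hessian L x i j| <= e'.
  move=> zy; apply/ltW/Hd => //; rewrite -(subrK y z) -addrA.
  by apply: le_lt_trans (ler_normD _ _) _; lra.
have /andP[h1 h2] := avg_sharpness_bounds hL rho0 HB.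
have rho2 : 0 <= rho ^+ 2 by exact: sqr_ge0.
apply/andP; split; [apply: le_trans h1|apply: le_trans h2 _];
  by rewrite lee_fin ler_wpM2l// ?lerD2l// lerN2.
Unshelve. all: by end_near. Qed.

(** The lower bound passes to the infimum; for the upper one the centre [x] is itself a
    competitor. *)
Lemma local_inf_bounds (Rf : regularizer_family R D) (rho r : R) x (a b : R) :
  0 < rho -> 0 <= r ->
  (forall y, l2norm (y - x) <= r ->
    ((rho ^+ 2 * a)%:E <= Rf rho y <= (rho ^+ 2 * b)%:E)%E) ->
  (a%:E <= local_inf Rf rho r x <= b%:E)%E.
Proof.
move=> rho0 r0 H.
have rho2 : 0 < rho ^+ 2 by rewrite exprn_gt0.
have K c : (c%:E = (rho ^+ 2 * c)%:E * (rho ^- 2)%:E)%E.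
  by rewrite -EFinM mulrAC divff ?mul1r// gt_eqF.
have i0 : (0 <= (rho ^- 2)%:E)%E by rewrite lee_fin invr_ge0 ltW.
apply/andP; split.
  apply: le_ereal_inf_tmp => _ [y yx <-]; rewrite (K a) lee_wpmul2r//.
  by have /andP[] := H y yx.
have xr : l2norm (x - x) <= r.
  by rewrite subrr -(scale0r (0 : 'rV[R]_D)) l2normZ normr0 mul0r.
have /andP[_ h] := H x xr.
apply: (@le_trans _ _ (Rf rho x * (rho ^- 2)%:E)%E).
  by apply: ereal_inf_lbound; exists x.
by rewrite (K b) lee_wpmul2r.
Qed.

(** Enlarging the ball can only lower the infimum, so the inner limit exists by monotonicity. *)
Lemma local_inf_cvg (Rf : regularizer_family R D) (rho : R) x :
  cvg (local_inf Rf rho r x @[r --> 0^'+]).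
Proof.
apply: nonincreasing_at_right_is_cvge; near=> b => r s _ _ rs.
by apply: ereal_inf_le_tmp; apply: image_subset => y /=; move/le_trans; apply.
Unshelve. all: by end_near. Qed.

Lemma half_mean_trace_ge0 L x :
  Ck_on 2 setT L -> local_minimizer L x -> 0 <= half_mean_trace L x.
Proof.
move=> hL /nbhs_normP[r /= r0 Hr]; rewrite leNgt; apply/negP => S0.
(* With this error the upper bound is half the supposedly negative trace term, still negative, while
   the sharpness at a local minimizer is nonnegative. *)
have e0 : 0 < - half_mean_trace L x / 2 by rewrite divr_gt0// oppr_gt0.
have [d d0 Hd] := avg_sharpness_uniform `|x| hL e0.
pose rho := Num.min d (r / 2).
have rho0 : 0 < rho by rewrite lt_min d0 divr_gt0.
have /andP[_] : ((rho ^+ 2 * (half_mean_trace L x - - half_mean_trace L x / 2))%:E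
    <= avg_sharpness L rho x
    <= (rho ^+ 2 * (half_mean_trace L x + - half_mean_trace L x / 2))%:E)%E.
  by apply: Hd => //; rewrite ?subrr ?normr0 ?(ltW d0)// ge_min lexx.
rewrite leNgt => /negP; apply.
apply: (@lt_le_trans _ _ 0%E).
  by rewrite lte_fin pmulr_rlt0 ?exprn_gt0//; lra.
apply: avg_sharpness_ge0 => // z zx; apply: Hr; rewrite /= distrC.
by apply: le_lt_trans zx _; rewrite gt_min; apply/orP; right; lra.
Qed.

(** * The limiting regularizer, its goodness, and the mild lower bound *)

Lemma local_inf_avg_sharpness_uniform L (M e : R) : Ck_on 2 setT L -> 0 < e ->
  exists2 d, 0 < d & forall x rho r, `|x| <= M -> 0 < rho -> rho <= d ->
    0 <= r -> r <= d ->
    ((half_mean_trace L x - e)%:E <= local_inf (avg_sharpness L) rho r x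
      <= (half_mean_trace L x + e)%:E)%E.
Proof.
move=> hL e0; have [d d0 Hd] := avg_sharpness_uniform M hL e0.
exists d => // x rho r xM rho0 rhod r0 rd; apply: local_inf_bounds => // y yx.
by apply: Hd => //; apply: le_trans (le_norm_l2norm _) (le_trans yx rd).
Qed.

Lemma avg_sharpness_limiting_regularizer L (Gamma : set 'rV[R]_D) :
  Ck_on 2 setT L ->
  limiting_regularizer (avg_sharpness L) Gamma (half_mean_trace L).
Proof.
move=> hL x _.
set l := fun rho => lim (local_inf (avg_sharpness L) rho r x @[r --> 0^'+]).
have Hl e : 0 < e -> \forall rho \near 0^'+,
    ((half_mean_trace L x - e)%:E <= l rho <= (half_mean_trace L x + e)%:E)%E.
  move=> e0; have [d d0 Hd] := local_inf_avg_sharpness_uniform `|x| hL e0.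
  near=> rho.
  have H : \forall r \near 0^'+, ((half_mean_trace L x - e)%:E <=
      local_inf (avg_sharpness L) rho r x <= (half_mean_trace L x + e)%:E)%E.
    have rhod : rho <= d by near: rho; exact: nbhs_right_le.
    by near=> r; apply: Hd => //; near: r; exact: nbhs_right_le.
  apply/andP; split; [apply: lime_ge|apply: lime_le];
    try exact: local_inf_cvg; by apply: filterS H => r /andP[].
(* Convergence in the extended reals: first eventual finiteness, from the bounds with error 1, then
   convergence of the real values. *)
apply/fine_cvgP; split.
  near=> rho; rewrite fin_numElt.
  have /andP[h1 h2] : ((half_mean_trace L x - 1)%:E <= l rho <=
    (half_mean_trace L x + 1)%:E)%E by near: rho; exact: Hl.
  by rewrite (lt_le_trans _ h1) ?ltNyr// (le_lt_trans h2)// ltry.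
apply/cvgrPdist_le => e e0; near=> rho.
have : ((half_mean_trace L x - e)%:E <= l rho <=
    (half_mean_trace L x + e)%:E)%E by near: rho; exact: Hl.
rewrite /=; case: (l rho) => [t| |] //=; last by rewrite leye_eq andbF.
by rewrite !lee_fin => /andP[h1 h2]; rewrite ler_norml; apply/andP; split; lra.
Unshelve. all: by end_near. Qed.

Lemma avg_sharpness_good_around L (Gamma : set 'rV[R]_D) xs :
  Ck_on 2 setT L -> local_minimizer L xs ->
  good_around (avg_sharpness L) Gamma (half_mean_trace L) xs.
Proof.
move=> hL xsmin; split; first exact: half_mean_trace_ge0.
  by apply: cvg_within_filter; exact: half_mean_trace_continuous.
exists (ball xs 1); split; [exact: ball_open|exact: ballxx|].
(* Halving [e] turns the non-strict bounds into the required strict one. *)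
move=> C e C0 e0; have e20 : 0 < e / 2 by rewrite divr_gt0.
have [d d0 Hd] := local_inf_avg_sharpness_uniform (`|xs| + 1) hL e20.
(* The bound [d / C] ensures that the ball radius [C * rho] is at most [d]. *)
exists (Num.min d (d / C)); first by rewrite lt_min d0 divr_gt0.
move=> x _ xV rho rho0; rewrite le_min => /andP[rhod rhoC].
have xM : `|x| <= `|xs| + 1.
  rewrite -(subrK xs x) addrC (le_trans (ler_normD _ _))// lerD2l distrC ltW//.
  by move: xV; rewrite -ball_normE.
have : ((half_mean_trace L x - e / 2)%:E <=
    local_inf (avg_sharpness L) rho (C * rho) x <=
    (half_mean_trace L x + e / 2)%:E)%E.
  apply: Hd => //; first by rewrite mulr_ge0 ?ltW.
  by rewrite mulrC -ler_pdivlMr.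
case: (local_inf _ _ _ _) => [t| |] //=; last by rewrite leye_eq andbF.
by rewrite !lee_fin lte_fin ltr_norml => /andP[h1 h2]; apply/andP; split; lra.
Qed.

Lemma avg_sharpness_mildly_bounded_below L (U : set 'rV[R]_D) :
  Ck_on 2 setT L -> mildly_bounded_below (avg_sharpness L) U.
Proof.
move=> hL B [M [_ HM]] _ _.
have BM x : B x -> `|x| <= M + 1 by apply: HM; rewrite ltrDl.
have [d d0 Hd] := avg_sharpness_uniform (M + 1) hL ltr01.
have [C HC] := bounded_on_ball (M + 1) (half_mean_trace_continuous hL).
(* [|C|] bounds the trace term on a ball containing [B], and 1 is the error in the uniform
   estimate. *)
exists (`|C| + 1); first by rewrite ltr_wpDl.
near=> rho => x Bx; have xM := BM x Bx.
have /andP[h _] : ((rho ^+ 2 * (half_mean_trace L x - 1))%:E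
    <= avg_sharpness L rho x <= (rho ^+ 2 * (half_mean_trace L x + 1))%:E)%E.
  apply: Hd => //; first by rewrite subrr normr0 ltW.
  by near: rho; exact: nbhs_right_le.
apply: le_trans h; rewrite lee_fin mulrC -mulrN ler_wpM2l ?sqr_ge0//.
have := HC x xM; rewrite ler_norml => /andP[h _].
by have := ler_norm C; lra.
Unshelve. all: by end_near. Qed.

End AvgSharpness.

Theorem theoremE5 (R : realType) (D M : nat) (hM : (1 <= M <= D)%N)
  (L : 'rV[R]_D -> R) (Gamma : set 'rV[R]_D)
  (hL : Ck_on 4 [set: 'rV[R]_D] L)
  (hGamma : Ck_submanifold 2 (D - M)%N Gamma)
  (hmin : forall x, Gamma x -> local_minimizer L x)
  (hrank : forall x, Gamma x -> \rank (hessian L x) = M) :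
  admits_good_limiting_regularizer (avg_sharpness L) Gamma
    (fun x => \tr (hessian L x) / (2 * D%:R)) /\
  mildly_bounded_below (avg_sharpness L) (attraction_set L Gamma).
Proof.
have hL2 : Ck_on 2 setT L by do 2 apply: Ck_onW.
split; last exact: avg_sharpness_mildly_bounded_below.
split; first exact: avg_sharpness_limiting_regularizer.
by move=> xs Gxs; apply: avg_sharpness_good_around => //; exact: hmin.
Qed.
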